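(* For $i\in\{1,2\}$ let $G_i$ be a finite graph on $n_i$ vertices with maximum degree $\Delta(G_i)<\frac{1}{9}n_i-\frac{1}{3}$, and let $k_i$ be a natural number with $k_i>\chi(G_i)$. If $\mathcal{B}_{k_1}(G_1)\cong\mathcal{B}_{k_2}(G_2)$, then $G_1\cong G_2$. (That is, such a graph $G$ is uniquely determined by $\mathcal{B}_k(G)$ whenever $k>\chi(G)$, even without knowing $k$.)
   Context: All graphs are finite and simple; $\chi(G)$ is the chromatic number. An independent set partition of $G$ is a partition of $V(G)$ into nonempty independent sets (parts). For an independent set partition $P$ and $v\in V(G)$, let $P-v$ denote the partition of $V(G)\setminus\{v\}$ obtained by deleting $v$ from its part (discarding that part if it becomes empty). The Bell colouring graph $\mathcal{B}(G)$ has as vertices the independent set partitions of $G$, with $P\neq Q$ adjacent iff $P-v=Q-v$ for some $v\in V(G)$. For a natural number $k$, the Bell $k$-colouring graph $\mathcal{B}_k(G)$ is the induced subgraph of $\mathcal{B}(G)$ on the partitions with at most $k$ parts. *)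

(* Defs.v *)
From mathcomp Require Import all_boot.

Set Implicit Arguments.
Unset Strict Implicit.
Unset Printing Implicit Defensive.

Record sgraph := SGraph {
  vertex :> finType;
  adj : rel vertex;
  adj_sym : symmetric adj;
  adj_irrefl : irreflexive adj
}.

Definition isomorphic (G H : sgraph) : Prop :=
  exists2 f : G -> H, bijective f & {mono f : x y / adj x y}.

Definition degree (G : sgraph) (x : G) : nat := #|[set y | adj x y]|.

Definition max_degree (G : sgraph) : nat := \max_(x : G) degree x.

Definition colourable (G : sgraph) (k : nat) : bool :=
  [exists f : {ffun G -> 'I_k}, [forall x, forall y, adj x y ==> (f x != f y)]].

Lemma colourable_card (G : sgraph) : exists k, colourable G k.
Proof.
exists #|G|; apply/existsP; exists [ffun x => enum_rank x].
apply/forallP => x; apply/forallP => y; apply/implyP => xy.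
rewrite !ffunE (inj_eq enum_rank_inj).
by apply: contraTneq xy => ->; rewrite adj_irrefl.
Qed.

Definition chromatic_number (G : sgraph) : nat := ex_minn (colourable_card G).

Section Induced.
Variables (G : sgraph) (A : {set G}).

Definition induced_adj (x y : {x : G | x \in A}) : bool := adj (val x) (val y).

Lemma induced_adj_sym : symmetric induced_adj.
Proof. by move=> x y; rewrite /induced_adj adj_sym. Qed.

Lemma induced_adj_irrefl : irreflexive induced_adj.
Proof. by move=> x; rewrite /induced_adj adj_irrefl. Qed.

Definition induced : sgraph := SGraph induced_adj_sym induced_adj_irrefl.

End Induced.

Section Bell.
Variable G : sgraph.

Definition independent (B : {set G}) : bool :=
  [forall x in B, forall y in B, ~~ adj x y].

(* [partition] already requires the parts to be nonempty. *)
Definition indep_partition (P : {set {set G}}) : bool :=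
  partition P [set: G] && [forall B in P, independent B].

Definition delete_vertex (P : {set {set G}}) (v : G) : {set {set G}} :=
  [set B :\ v | B in P] :\ set0.

Definition bell_adj (P Q : {P : {set {set G}} | indep_partition P}) : bool :=
  (P != Q) && [exists v, delete_vertex (val P) v == delete_vertex (val Q) v].

Lemma bell_adj_sym : symmetric bell_adj.
Proof.
move=> P Q; rewrite /bell_adj eq_sym; congr (_ && _).
by apply: eq_existsb => v; rewrite eq_sym.
Qed.

Lemma bell_adj_irrefl : irreflexive bell_adj.
Proof. by move=> P; rewrite /bell_adj eqxx. Qed.

Definition bell_graph : sgraph := SGraph bell_adj_sym bell_adj_irrefl.

Definition bell_k_graph (k : nat) : sgraph :=
  induced [set P : bell_graph | #|val P| <= k].

End Bell.

(* Main.v *)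
Require Import Defs.
From mathcomp Require Import all_boot all_order all_algebra.
From mathcomp Require Import zify lra.

(** Let [P] be a vertex of the Bell [k]-colouring graph. For each vertex [v] of
    [G], the partitions obtained from [P] by moving [v] form, together with [P],
    a clique, and these [n] cliques cover the neighbourhood of [P]. Moves of two
    nonadjacent vertices commute, so they have a common neighbour besides [P].
    Consequently, whenever the neighbourhood of some [P] contains [n] nonempty,
    pairwise anticomplete sets [X_u], these correspond to the vertices of [G],
    and if the members [z], [w] of [X_u], [X_v] have [P] as their only common
    neighbour, then [u] and [v] are adjacent.

    Conversely, let [P] be a colouring with [m = min (k - 1, 2 Delta + 1)]
    colours in which every class has at least 4 vertices. The moves of the
    different vertices are then anticomplete, and two adjacent vertices [u], [v]
    can move to a common class [l] not adjacent to them: a nonempty one if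
    [m = 2 Delta + 1], the only empty one if [m = k - 1]. The two resulting
    partitions have no common neighbour besides [P].

    Comparing both facts along an isomorphism of Bell colouring graphs yields
    bijective homomorphisms [G1 -> G2] and [G2 -> G1], and two finite graphs
    with that property are isomorphic. *)

Import Order.TTheory GRing.Theory Num.Theory.

Set Implicit Arguments.
Unset Strict Implicit.
Unset Printing Implicit Defensive.

Local Open Scope nat_scope.

(** * Partitions and the colourings that represent them *)

Definition proper_colouring (G : sgraph) (T : eqType) (c : G -> T) : Prop :=
  forall x y, adj x y -> c x != c y.

Definition represents (G : sgraph) (T : eqType) (P : {set {set G}})
    (c : G -> T) : Prop :=
  forall x y, (pblock P x == pblock P y) = (c x == c y).

Section Partitions.
Variables (G : sgraph).
Implicit Types (P Q : {set {set G}}) (v x y : G).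

Lemma mem_pblock_partition P x : partition P setT -> x \in pblock P x.
Proof. by move=> PP; rewrite mem_pblock (cover_partition PP) inE. Qed.

Lemma pblock_partition P B x :
  partition P setT -> B \in P -> x \in B -> pblock P x = B.
Proof. by move=> PP; apply: def_pblock; apply: partition_trivIset PP. Qed.

Lemma part_pblock P B :
  partition P setT -> B \in P -> exists2 x, x \in B & B = pblock P x.
Proof.
move=> PP BP; have /set0Pn [x xB] : B != set0.
  by apply: contraTneq BP => ->; rewrite (partition0 PP).
by exists x => //; rewrite (pblock_partition PP BP xB).
Qed.

Lemma in_pblock P x y : partition P setT ->
  (y \in pblock P x) = (pblock P x == pblock P y).
Proof.
move=> PP; rewrite eq_pblock ?(partition_trivIset PP) //.
by rewrite (cover_partition PP) inE.
Qed.

Lemma pblock_in P x : partition P setT -> pblock P x \in P.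
Proof. by move=> PP; rewrite pblock_mem // (cover_partition PP) inE. Qed.

Lemma delete_vertex_sub P Q v : partition P setT -> partition Q setT ->
  (forall x y, x != v -> y != v ->
     (pblock P x == pblock P y) = (pblock Q x == pblock Q y)) ->
  delete_vertex P v \subset delete_vertex Q v.
Proof.
move=> PP QP PQ; apply/subsetP => C.
rewrite !inE => /andP[C0 /imsetP[B BP defC]]; rewrite C0 /=.
have /set0Pn [x] := C0; rewrite defC !inE => /andP[xv xB].
apply/imsetP; exists (pblock Q x); first exact: pblock_in.
apply/setP => y; rewrite !inE; have [//|yv /=] := eqVneq y v.
by rewrite -(pblock_partition PP BP xB) !in_pblock // PQ.
Qed.

(** Replaces set-level deletion by the equivalence relation off [v], which can be checked on
    labels. *)
Lemma delete_vertexP P Q v : partition P setT -> partition Q setT ->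
  delete_vertex P v = delete_vertex Q v <->
  (forall x y, x != v -> y != v ->
     (pblock P x == pblock P y) = (pblock Q x == pblock Q y)).
Proof.
move=> PP QP; split=> [PQ|PQ]; last first.
  apply/eqP; rewrite eqEsubset !delete_vertex_sub // => x y xv yv.
  by rewrite PQ.
suff sub P' Q' : partition P' setT -> partition Q' setT ->
    delete_vertex P' v = delete_vertex Q' v -> forall x y, x != v -> y != v ->
    pblock P' x == pblock P' y -> pblock Q' x == pblock Q' y.
  by move=> x y xv yv; apply/idP/idP; apply: sub.
move=> PP' QP' PQ' x y xv yv; rewrite -in_pblock // => yx.
have: pblock P' x :\ v \in delete_vertex P' v.
  rewrite !inE; apply/andP; split.
    by apply/set0Pn; exists x; rewrite !inE xv mem_pblock_partition.
  by apply/imsetP; exists (pblock P' x); rewrite ?pblock_in.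
rewrite PQ' !inE => /andP[_ /imsetP[B BQ defB]].
have inB z : z != v -> z \in pblock P' x -> z \in B.
  by move=> zv zx; move/setP/(_ z): defB; rewrite !inE zv zx.
rewrite (pblock_partition QP' BQ (inB _ xv _)) ?mem_pblock_partition //.
by rewrite (pblock_partition QP' BQ (inB _ yv _)).
Qed.

Lemma partition_eqP P Q : partition P setT -> partition Q setT ->
  (forall x y, (pblock P x == pblock P y) = (pblock Q x == pblock Q y)) -> P = Q.
Proof.
move=> PP QP PQ; apply/setP => B.
suff sub P' Q' : partition P' setT -> partition Q' setT ->
    (forall x y, (pblock P' x == pblock P' y) = (pblock Q' x == pblock Q' y)) ->
    B \in P' -> B \in Q'.
  by apply/idP/idP; apply: sub.
move=> PP' QP' PQ' /(part_pblock PP')[x xB ->].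
suff -> : pblock P' x = pblock Q' x by apply: pblock_in.
by apply/setP=> y; rewrite !in_pblock.
Qed.

Lemma represents_preim (T : finType) (c : G -> T) :
  represents (preim_partition c setT) c.
Proof.
move=> x y; have PP := preim_partitionP c setT.
rewrite -in_pblock // /preim_partition pblock_equivalence_partition //.
by move=> a b d _ _ _ /=; split=> // /eqP->.
Qed.

Lemma card_preim_partition (T : finType) (c : G -> T) :
  #|preim_partition c setT| <= #|T|.
Proof.
have /subset_leq_card : preim_partition c setT
    \subset [set [set y | i == c y] | i : T].
  apply/subsetP => B /imsetP[x _ ->]; apply/imsetP; exists (c x) => //.
  by apply/setP => y; rewrite !inE.
by move/leq_trans; apply; apply: leq_imset_card.
Qed.

Lemma partition_label P k : #|P| <= k -> partition P setT ->
  exists c : G -> 'I_k, represents P c.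
Proof.
move=> Pk PP; have ltk x : index (pblock P x) (enum P) < k.
  by apply: leq_trans Pk; rewrite cardE index_mem mem_enum pblock_in.
exists (fun x => Ordinal (ltk x)) => x y; rewrite -[RHS]val_eqE /=.
have nthP z : nth set0 (enum P) (index (pblock P z) (enum P)) = pblock P z.
  by rewrite nth_index // mem_enum pblock_in.
by apply/eqP/eqP => [-> //|xy]; rewrite -nthP xy nthP.
Qed.

Lemma indep_partitionP (T : eqType) P (c : G -> T) : partition P setT ->
  represents P c -> indep_partition P <-> proper_colouring c.
Proof.
move=> PP Pc; rewrite /indep_partition PP /=; split.
  move=> /forall_inP Pi x y; apply: contraTneq => /eqP xy.
  have yx : y \in pblock P x by rewrite in_pblock // Pc.
  by have /forall_inP/(_ x)/(_ (mem_pblock_partition x PP))/forall_inP/(_ y)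
    /(_ yx) := Pi _ (pblock_in x PP).
move=> cP; apply/forall_inP => B /(part_pblock PP)[z _ ->].
apply/forall_inP => x; rewrite in_pblock // => /eqP xz.
apply/forall_inP => y; rewrite in_pblock // xz Pc => xy.
by apply/negP => /cP; rewrite xy.
Qed.

End Partitions.

(** * Vertices and adjacency of the Bell graph in terms of labels *)

Section BellVertices.
Variables (G : sgraph) (k : nat).
Implicit Types (P Q R : bell_k_graph G k).

Definition parts P : {set {set G}} := val (val P).

(** Allows [P = Q], which makes it an equivalence relation for each fixed [v]. *)
Definition agree_off (v : G) P Q : bool :=
  delete_vertex (parts P) v == delete_vertex (parts Q) v.

Lemma partition_parts P : partition (parts P) setT.
Proof. by case/andP: (valP (val P)). Qed.

Lemma adjE P Q : adj P Q = (P != Q) && [exists v, agree_off v P Q].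
Proof. by rewrite -(inj_eq val_inj). Qed.

Lemma agree_adj v P Q : agree_off v P Q -> P = Q \/ adj P Q.
Proof.
move=> PQ; have [->|nPQ] := eqVneq P Q; [by left | right].
by rewrite adjE nPQ; apply/existsP; exists v.
Qed.

Lemma ex_label P :
  exists2 c : G -> 'I_k, represents (parts P) c & proper_colouring c.
Proof.
have Pk : #|parts P| <= k by have := valP P; rewrite inE.
have [c Pc] := partition_label Pk (partition_parts P).
by exists c => //; apply/(indep_partitionP (partition_parts P) Pc)/(valP (val P)).
Qed.

Lemma ex_vertex (c : G -> 'I_k) : proper_colouring c -> exists P, represents (parts P) c.
Proof.
move=> cP; have Pc := represents_preim c.
have /(indep_partitionP (preim_partitionP c setT) Pc) Pi := cP.
pose Q : bell_graph G := Sub (preim_partition c setT) Pi.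
have Qk : Q \in [set P : bell_graph G | #|val P| <= k].
  by rewrite inE -[k in _ <= k]card_ord; apply: card_preim_partition.
by exists (Sub Q Qk).
Qed.

Lemma agree_offP (T U : eqType) (c : G -> T) (d : G -> U) v P Q :
  represents (parts P) c -> represents (parts Q) d ->
  reflect (forall x y, x != v -> y != v -> (c x == c y) = (d x == d y))
    (agree_off v P Q).
Proof.
move=> Pc Qd; apply: (iffP eqP).
  move/(delete_vertexP v (partition_parts P) (partition_parts Q)) => PQ x y.
  by move=> xv yv; rewrite -Pc -Qd PQ.
move=> cd; apply/(delete_vertexP v (partition_parts P) (partition_parts Q)).
by move=> x y xv yv; rewrite Pc Qd cd.
Qed.

Lemma represents_inj (T U : eqType) (c : G -> T) (d : G -> U) P Q :
  represents (parts P) c -> represents (parts Q) d ->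
  (forall x y, (c x == c y) = (d x == d y)) -> P = Q.
Proof.
move=> Pc Qd cd; apply/val_inj/val_inj.
apply: partition_eqP; [exact: partition_parts P | exact: partition_parts Q |].
by move=> x y; rewrite [LHS]Pc [RHS]Qd.
Qed.

End BellVertices.

(** * Local models and their transport *)

(** Only adjacency in [B] occurs, so isomorphisms preserve it. The last clause is one-way, hence it
    will yield homomorphisms only. *)
Definition local_model (H B : sgraph) (P : B) (X : H -> {set B}) : Prop :=
  [/\ forall u, exists z, z \in X u,
      forall u z, z \in X u -> adj P z,
      forall u v z w, z \in X u -> w \in X v -> z = w \/ adj z w -> u = v &
      forall u v, adj u v -> exists z w,
        [/\ z \in X u, w \in X v & forall R, adj R z -> adj R w -> R = P]].

Lemma local_model_iso (H B B' : sgraph) (P : B) (X : H -> {set B})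
    (f : B -> B') : bijective f -> {mono f : x y / adj x y} ->
  local_model P X -> local_model (f P) (fun u => f @: X u).
Proof.
move=> /[dup] /bij_inj f_inj [g fK gK] f_mono [X0 XP Xsep Xadj]; split.
- by move=> u; have [z zX] := X0 u; exists (f z); apply: imset_f.
- by move=> u z /imsetP[x xX ->]; rewrite f_mono; apply: XP xX.
- move=> u v z w /imsetP[x xX ->] /imsetP[y yX ->] xy; apply: Xsep xX yX _.
  by case: xy => [/f_inj|]; [left | rewrite f_mono; right].
move=> u v /Xadj[z [w [zX wX zwP]]]; exists (f z), (f w); split.
- exact: imset_f.
- exact: imset_f.
by move=> R; rewrite -(gK R) !f_mono => Rz Rw; rewrite (zwP (g R)).
Qed.

(** * Commuting moves of nonadjacent vertices *)

Lemma card_imset_coarser (T U V : finType) (c : T -> U) (d : T -> V)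
    (S : {set T}) : {in S &, forall x y, c x = c y -> d x = d y} ->
  #|d @: S| <= #|c @: S|.
Proof.
move=> cd; have [->|/set0Pn [x0 x0S]] := eqVneq S set0; first by rewrite imset0 cards0.
(* On [S], [d] factors through [c] via [g]; the default [d x0] is only reached outside [c @: S]. *)
pose g i := odflt (d x0) (omap d [pick x in S | c x == i]).
suff /subset_leq_card : d @: S \subset g @: (c @: S).
  by move/leq_trans; apply; apply: leq_imset_card.
apply/subsetP => _ /imsetP[x xS ->].
apply/imsetP; exists (c x); first exact: imset_f.
rewrite /g; case: pickP => [y /andP[yS /eqP cy] | /(_ x)] /=.
  by apply: cd.
by rewrite xS eqxx.
Qed.

(** [R] performs both moves: it follows [z] except that [b] goes where [w] puts it. The two may end
    up in one part, which is allowed because they are not adjacent. *)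
Lemma moves_commute (G : sgraph) k (a b : G) (Q z w : bell_k_graph G k) :
  a != b -> ~~ adj a b -> agree_off a Q z -> agree_off b Q w ->
  exists R, agree_off b R z /\ agree_off a R w.
Proof.
move=> ab nab Qz Qw.
have [q Qq _] := ex_label Q; have [cz zc czP] := ex_label z.
have [cw wc cwP] := ex_label w; pose S := ~: [set a; b].
have inS x : (x \in S) = (x != a) && (x != b) by rewrite !inE negb_or.
have cE x y : x \in S -> y \in S -> (cz x == cz y) = (cw x == cw y).
  rewrite !inS => /andP[xa xb] /andP[ya yb].
  by rewrite -(agree_offP a Qq zc Qz) // (agree_offP b Qq wc Qw).
have [l lP] : exists l, {in S, forall x, (cz x == l) = (cw x == cw b)}.
  have [/exists_inP[x xS /eqP xb]|/exists_inPn nb] :=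
      boolP [exists x in S, cw x == cw b].
    by exists (cz x) => y yS; rewrite cE // xb.
  have: #|cz @: S| < k.
    apply: (@leq_ltn_trans #|cw @: S|).
      by apply: card_imset_coarser => x y xS yS /eqP; rewrite -cE // => /eqP.
    rewrite -[X in _ < X]card_ord; apply: proper_card; apply/properP; split.
      exact: subset_predT.
    exists (cw b) => //; apply/imsetP => -[x xS bx].
    by have := nb x xS; rewrite bx eqxx.
  have [/forallP all_c|/forallPn [l lP] _] := boolP [forall l, l \in cz @: S].
    suff -> : #|cz @: S| = k by rewrite ltnn.
    by rewrite -[RHS]card_ord; apply: eq_card => l; rewrite all_c.
  exists l => x xS; rewrite (negbTE (nb x xS)); apply: contraNF lP.
  by move/eqP <-; apply: imset_f.
pose r x := if x == b then l else cz x.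
have rE1 x y : x != b -> y != b -> (r x == r y) = (cz x == cz y).
  by rewrite /r => /negbTE-> /negbTE->.
have rE2 x y : x != a -> y != a -> (r x == r y) = (cw x == cw y).
  rewrite /r => xa ya; case: (eqVneq x b) => [->|xb]; case: (eqVneq y b) => [->|yb].
  - by rewrite !eqxx.
  - by rewrite eq_sym lP ?inS ?ya // eq_sym.
  - by rewrite lP ?inS ?xa.
  - by rewrite cE ?inS ?xa ?ya.
(* Every edge avoids [a] or [b], so properness is inherited from [cw] or [cz]. *)
have rP : proper_colouring r.
  move=> x y xy; have [xb|xb] := eqVneq x b; last first.
    have [yb|yb] := eqVneq y b; last by rewrite rE1 ?czP.
    have [xa|xa] := eqVneq x a; first by rewrite xa yb (negbTE nab) in xy.
    by rewrite rE2 ?cwP // yb eq_sym.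
  have [ya|ya] := eqVneq y a.
    by rewrite xb ya adj_sym (negbTE nab) in xy.
  by rewrite rE2 ?cwP // xb eq_sym.
have [R Rr] := ex_vertex rP; exists R; split.
  exact/(agree_offP b Rr zc).
exact/(agree_offP a Rr wc).
Qed.

Lemma agree_off_trans (G : sgraph) k (v : G) (P Q R : bell_k_graph G k) :
  agree_off v P Q -> agree_off v P R -> agree_off v Q R.
Proof. by rewrite /agree_off => /eqP-> /eqP->. Qed.

Lemma agree_off_sym (G : sgraph) k (v : G) (P Q : bell_k_graph G k) :
  agree_off v P Q -> agree_off v Q P.
Proof. by rewrite /agree_off eq_sym. Qed.

(** * Reading a homomorphism off a model in a Bell graph *)

Section ModelInBell.
Variables (G H : sgraph) (k : nat) (Q : bell_k_graph G k).
Variable X : H -> {set bell_k_graph G k}.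
Hypothesis modelX : local_model Q X.

(** Two partitions obtained from [Q] by moving the same vertex are equal or adjacent, so separation
    makes the moved vertices distinct. *)
Lemma model_moved : exists2 f : H -> G, injective f &
  forall u, exists2 z, z \in X u & agree_off (f u) Q z.
Proof.
have [X0 XQ Xsep _] := modelX.
have fP u : exists v, [exists z in X u, agree_off v Q z].
  have [z zX] := X0 u; have := XQ u z zX.
  rewrite adjE => /andP[_ /existsP[v Qz]]; exists v.
  by apply/exists_inP; exists z.
exists (fun u => xchoose (fP u)); last first.
  by move=> u; have /exists_inP[z] := xchooseP (fP u); exists z.
move=> u v fuv; have /exists_inP[z zX Qz] := xchooseP (fP u).
have /exists_inP[w wX Qw] := xchooseP (fP v).
apply: (Xsep u v z w) => //; apply: agree_adj; apply: agree_off_trans Qz _.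
by rewrite fuv.
Qed.

Lemma card_model : #|H| <= #|G|.
Proof. by have [f f_inj _] := model_moved; apply: leq_card f_inj. Qed.

(** If [f u] and [f v] were not adjacent, their moves would commute to a common neighbour [R] of [z]
    and [w]. Then [R = Q], so [z] is also a move of [f v], against separation. *)
Lemma model_hom : #|G| <= #|H| ->
  exists2 f : H -> G, bijective f & forall u v, adj u v -> adj (f u) (f v).
Proof.
move=> GH; have [f f_inj fP] := model_moved.
have f_bij := inj_card_bij f_inj GH; exists f => //; have [g fK gK] := f_bij.
have [X0 XQ Xsep Xadj] := modelX.
(* As [f] is onto, the vertex moved in [z] is also moved by some member of [X (g v)]; separation
   gives [u = g v]. *)
have moved u z : z \in X u -> agree_off (f u) Q z.
  move=> zX; have := XQ u z zX; rewrite adjE => /andP[_ /existsP[v Qz]].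
  have [w wX Qw] := fP (g v); rewrite gK in Qw.
  by rewrite (Xsep _ _ _ _ zX wX (agree_adj (agree_off_trans Qz Qw))) gK.
move=> u v uv; have [z [w [zX wX Qonly]]] := Xadj u v uv.
have nuv : u != v by apply: contraTneq uv => ->; rewrite adj_irrefl.
have [Qz Qw] := (moved u z zX, moved v w wX).
apply/negPn/negP => nadj.
have fuv : f u != f v by rewrite (inj_eq f_inj).
have [R [Rz Rw]] := moves_commute fuv nadj Qz Qw.
have sep : z = w \/ adj z w -> False.
  by move/(Xsep _ _ _ _ zX wX)/eqP; rewrite (negbTE nuv).
have Rz' : adj R z.
  by case: (agree_adj Rz) => // RE; case: sep; rewrite -RE; apply: agree_adj Rw.
have Rw' : adj R w.
  case: (agree_adj Rw) => // RE; case: sep; rewrite -RE; apply: agree_adj.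
  exact: agree_off_sym Rz.
apply: sep; rewrite (Qonly R Rz' Rw') in Rz.
exact: agree_adj (agree_off_trans Rz Qw).
Qed.

End ModelInBell.

(** * Free colours, recolouring and the chromatic number *)

Definition neighbours (G : sgraph) (x : G) : {set G} := [set y | adj x y].

Definition colour_class (G : sgraph) m (c : G -> 'I_m) (l : 'I_m) : {set G} :=
  [set x | c x == l].

Definition recolour (G : sgraph) m (c : G -> 'I_m) (x : G) (l : 'I_m) (y : G) :=
  if y == x then l else c y.

Lemma card_neighbours (G : sgraph) (x : G) : #|neighbours x| <= max_degree G.
Proof. exact: leq_bigmax (x : G). Qed.

Lemma free_label (T U : finType) (c : T -> U) (A : {set T}) (L : {set U}) :
  #|A| < #|L| -> exists2 l, l \in L & {in A, forall x, c x != l}.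
Proof.
move=> AL; have /subsetPn [l lL lA] : ~~ (L \subset c @: A).
  apply: contraL AL => /subset_leq_card LA; rewrite -leqNgt.
  by apply: leq_trans LA _; apply: leq_imset_card.
by exists l => // x xA; apply: contraNneq lA => <-; apply: imset_f.
Qed.

Lemma card_bigcup_bound (I T : finType) (A : {set I}) (F : I -> {set T}) d :
  {in A, forall i, #|F i| <= d} -> #|\bigcup_(i in A) F i| <= #|A| * d.
Proof.
move=> Fd; rewrite -sum_nat_const.
apply: (big_rec2 (fun (B : {set T}) n => #|B| <= n)); first by rewrite cards0.
move=> i n B iA Bn; apply: leq_trans (leq_card_setU _ _) _.
by rewrite leq_add // Fd.
Qed.

Lemma colourableP (G : sgraph) k :
  reflect (exists c : G -> 'I_k, proper_colouring c) (colourable G k).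
Proof.
apply: (iffP existsP) => [[f /forallP fP]|[c cP]].
  by exists f => x y; apply/implyP; move/forallP: (fP x) => /(_ y).
exists [ffun x => c x]; apply/forallP => x; apply/forallP => y.
by apply/implyP => /cP; rewrite !ffunE.
Qed.

Lemma chromatic_numberP (G : sgraph) : colourable G (chromatic_number G).
Proof. by rewrite /chromatic_number; case: ex_minnP. Qed.

(* When more than Delta + 1 colours are available, every vertex of the last
   class can be recoloured, all at once since the class is independent. *)
Lemma chromatic_number_degree (G : sgraph) :
  chromatic_number G <= (max_degree G).+1.
Proof.
rewrite /chromatic_number; case: ex_minnP => -[//|m] /colourableP[c cP] minm.
rewrite leqNgt; apply/negP => Dm; suff /minm : colourable G m by rewrite ltnn.
have free x : exists l : 'I_m, [forall (y | adj x y), c y != lift ord_max l].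
  have [|l] := @free_label _ _ c (neighbours x) [set~ ord_max].
    rewrite cardsC1 card_ord; apply: leq_ltn_trans (card_neighbours x) _.
    by rewrite -ltnS.
  rewrite !inE eq_sym => /unlift_some[i -> _] li; exists i.
  by apply/forall_inP => y xy; apply: li; rewrite inE.
apply/colourableP.
exists (fun x => odflt (xchoose (free x)) (unlift ord_max (c x))) => x y xy.
have := cP x y xy; case: unliftP => [i cx|cx]; case: unliftP => [j cy|cy] /=.
- by rewrite cx cy; apply: contraNneq => ->.
- move=> _; have /forall_inP/(_ x) := xchooseP (free y).
  by rewrite adj_sym xy => /(_ isT); apply: contraNneq => <-; rewrite -cx.
- move=> _; have /forall_inP/(_ y) := xchooseP (free x).
  by rewrite xy => /(_ isT); apply: contraNneq => ->; rewrite -cy.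
by rewrite cx cy eqxx.
Qed.

(** Both classes agree apart from [x]. The additive form avoids truncated subtraction and covers
    [c x = l]. *)
Lemma card_class_recolour (G : sgraph) m (c : G -> 'I_m) x l l' :
  #|colour_class (recolour c x l) l'| + (c x == l')
    = #|colour_class c l'| + (l == l').
Proof.
rewrite (cardsD1 x (colour_class (recolour _ _ _) _)) (cardsD1 x (colour_class c _)).
rewrite !inE /recolour eqxx addnAC [RHS]addnC addnA; congr (_ + _ + _).
by apply: eq_card => y; rewrite !inE; case: eqVneq.
Qed.

Lemma recolour_proper (G : sgraph) m (c : G -> 'I_m) x l :
  proper_colouring c -> (forall z, adj x z -> c z != l) ->
  proper_colouring (recolour c x l).
Proof.
move=> cP xl y z; rewrite /recolour.
case: (eqVneq y x) => [->|yx]; case: (eqVneq z x) => [->|zx].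
- by rewrite adj_irrefl.
- by move/xl; rewrite eq_sym.
- by rewrite adj_sym => /xl.
exact: cP.
Qed.

(** * Colourings with at least 4 vertices in every class *)

Section BigClasses.
Variables (G : sgraph) (m : nat).
Implicit Type c : G -> 'I_m.

(** With the cap at 4, a class of 5 or more can give up a vertex at no cost. *)
Let score c := \sum_l minn 4 #|colour_class c l|.

Lemma ex_max_score c0 : proper_colouring c0 ->
  exists2 c, proper_colouring c &
    forall c', proper_colouring c' -> score c' <= score c.
Proof.
pose P (f : {ffun G -> 'I_m}) :=
  [forall x, forall y, adj x y ==> (f x != f y)].
have PE (f : {ffun G -> 'I_m}) : reflect (proper_colouring f) (P f).
  apply: (iffP forallP) => fP x; last first.
    by apply/forallP => y; apply/implyP; apply: fP.
  by move=> y; apply/implyP; move/forallP: (fP x) => /(_ y).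
have cE c : score [ffun x => c x] = score c.
  apply: eq_bigr => l _; congr (minn _ _).
  by apply: eq_card => x; rewrite !inE ffunE.
have PF c : proper_colouring c -> P [ffun x => c x].
  by move=> cP; apply/PE => x y /cP; rewrite !ffunE.
move=> /PF c0P; have [f /PE fP fmax] := arg_maxnP (fun f : {ffun G -> 'I_m} => score f) c0P.
exists f => // c' /PF/fmax /=.
by rewrite cE.
Qed.

Lemma card_classes c : \sum_l #|colour_class c l| = #|G|.
Proof.
rewrite -sum1_card (partition_big c predT) //=.
by apply: eq_bigr => l _; rewrite -sum1dep_card.
Qed.

(* Take a colouring maximising [score], and suppose that the class of [a] has
   at most 3 vertices. A vertex of a class with at least 5 vertices is adjacent
   to that class, otherwise it could move there. Fix such a vertex [x]. If [y]
   is not adjacent to the class of [a], then [x] is adjacent to the class of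
   [y], otherwise [x] could move there while [y] moves to the class of [a].
   So there are at most 3D + 4D vertices. *)
Lemma ex_big_classes c0 D : proper_colouring c0 ->
  (forall x : G, #|neighbours x| <= D) -> 7 * D < #|G| -> 4 * m <= #|G| ->
  exists2 c : G -> 'I_m, proper_colouring c &
    forall l, 4 <= #|colour_class c l|.
Proof.
move=> c0P degD nD nm; have [c cP cmax] := ex_max_score c0P; exists c => // a.
rewrite leqNgt; apply/negP => a3.
have improve c' : proper_colouring c' ->
    (forall l, minn 4 #|colour_class c l| <= minn 4 #|colour_class c' l|) ->
    #|colour_class c a| < #|colour_class c' a| -> False.
  move=> /cmax le_score le_cl lt_a; move: le_score.
  rewrite /score (bigD1 a) //= [leqRHS](bigD1 a) //=.
  apply/negP; rewrite -ltnNge -addSn leq_add //; last by apply: leq_sum.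
  by move: a3 lt_a; lia.
pose nearA y := [exists z in colour_class c a, adj y z].
have nearAP y : ~~ nearA y -> forall z, adj y z -> c z != a.
  rewrite /nearA => /exists_inPn yA z yz; apply: contraTneq yz => za; apply: yA.
  by rewrite inE za.
have big_near y : 4 < #|colour_class c (c y)| -> nearA y.
  move=> ybig; apply: contraT => /nearAP yA; exfalso.
  apply: (improve (recolour c y a)).
  - exact: recolour_proper.
  - move=> l; have := card_class_recolour c y a l.
    by case: eqVneq => [<-|_]; case: eqVneq => [<-|_] /=; lia.
  have := card_class_recolour c y a a; rewrite eqxx.
  by case: eqVneq => [ya|_]; [rewrite ya in ybig | ]; lia.
(* Otherwise all classes have at most 4 vertices and that of [a] at most 3, fewer than [4 * m] in
   total. *)
have [x xbig] : exists x, 4 < #|colour_class c (c x)|.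
  apply/existsP; apply: contraT => /existsPn small; exfalso.
  have small' l : #|colour_class c l| <= 4.
    have [->|/set0Pn[x]] := eqVneq (colour_class c l) set0.
      by rewrite cards0.
    by rewrite inE => /eqP <-; rewrite leqNgt small.
  have: \sum_l #|colour_class c l| < \sum_(l < m) 4.
    by rewrite (bigD1 a) //= [ltnRHS](bigD1 a) //= -addSn leq_add // leq_sum.
  by rewrite card_classes sum_nat_const card_ord; lia.
have far_class y : ~~ nearA y ->
    exists2 z, z \in neighbours x & y \in colour_class c (c z).
  move=> yA; have [/exists_inP[z za xz]|] := boolP (nearA x); last first.
    by rewrite big_near.
  have [ya|nya] := eqVneq (c y) a.
    by exists z; rewrite inE // ya eq_sym; rewrite inE in za.
  apply/exists_inP; apply: contraT => /exists_inPn noz; exfalso.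
  have ysmall : #|colour_class c (c y)| <= 4.
    by rewrite leqNgt; apply: contra yA => /big_near.
  have xy : c x != c y by apply: contraTneq xbig => ->; rewrite -leqNgt.
  have yx : y != x by apply: contraNneq xy => ->.
  have c1P : proper_colouring (recolour c x (c y)).
    apply: recolour_proper => // w xw.
    by have := noz w; rewrite !inE eq_sym; apply.
  have xa : c x != a by apply: contraTneq xbig => ->; rewrite -leqNgt ltnW.
  have c1y : recolour c x (c y) y = c y by rewrite /recolour (negbTE yx).
  (* The class of [y] trades [y] for [x], and the class of [x] can spare a vertex. *)
  apply: (improve (recolour (recolour c x (c y)) y a)).
  - apply: recolour_proper => // w /(nearAP y yA); rewrite /recolour.
    by case: ifP.
  - move=> l; have := card_class_recolour (recolour c x (c y)) y a l.
    have := card_class_recolour c x (c y) l; rewrite c1y.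
    case: (eqVneq (c x) l) => [xl|_]; last by lia.
    by rewrite -xl (eq_sym (c y)) (negbTE xy); lia.
  have := card_class_recolour (recolour c x (c y)) y a a.
  have := card_class_recolour c x (c y) a; rewrite c1y eqxx.
  by rewrite (negbTE nya) (negbTE xa); lia.
have small_far y : ~~ nearA y -> #|colour_class c (c y)| <= 4.
  by move=> yA; rewrite leqNgt; apply: contra yA => /big_near.
pose S := [set z in neighbours x | #|colour_class c (c z)| <= 4].
have /subset_leq_card : [set: G] \subset
    \bigcup_(z in colour_class c a) neighbours z
      :|: \bigcup_(z in S) colour_class c (c z).
  apply/subsetP => y _; rewrite inE.
  have [/exists_inP[z za yz]|yA] := boolP (nearA y).
    by apply/orP; left; apply/bigcupP; exists z; rewrite // inE adj_sym.
  have [z xz yz] := far_class y yA.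
  apply/orP; right; apply/bigcupP; exists z => //.
  by rewrite inE xz; move: yz; rewrite inE => /eqP <-; apply: small_far.
rewrite cardsT; apply/negP; rewrite -ltnNge.
apply: leq_ltn_trans (leq_card_setU _ _) _.
have := @card_bigcup_bound _ _ (colour_class c a) (@neighbours G) D
  (fun z _ => degD z).
have := @card_bigcup_bound _ _ S (fun z => colour_class c (c z)) 4.
have SD : #|S| <= D.
  apply: leq_trans (degD x); apply: subset_leq_card.
  by apply/subsetP => z; rewrite inE => /andP[].
have H z : z \in S -> #|colour_class c (c z)| <= 4 by rewrite inE => /andP[].
move=> /(_ H) b1 b2.
have b3 : #|colour_class c a| * D <= 3 * D by rewrite leq_mul2r -ltnS a3 orbT.
have b4 : #|S| * 4 <= D * 4 by rewrite leq_mul2r SD orbT.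
lia.
Qed.

End BigClasses.

(** The source of the constant 4: a class mate must avoid up to three vertices. *)
Lemma ex_avoiding3 (T : finType) (A : {set T}) (a b d : T) : 4 <= #|A| ->
  exists y, [/\ y \in A, y != a, y != b & y != d].
Proof.
move=> A4; have /subsetPn [y yA] : ~~ (A \subset [set a; b; d]).
  apply: contraL A4 => /subset_leq_card Ale; rewrite -ltnNge ltnS.
  apply: leq_trans Ale _; rewrite setUC cardsU1 cards2.
  by case: (_ \notin _); case: (_ != _).
by rewrite !inE !negb_or => /andP[/andP[ya yb] yd]; exists y.
Qed.

(** * The local model at a colouring with large classes *)

Section BellModel.
Variables (G : sgraph) (k : nat) (c : G -> 'I_k) (P : bell_k_graph G k).
Hypothesis cP : proper_colouring c.
Hypothesis Pc : represents (parts P) c.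
Hypothesis big : forall x, 4 <= #|colour_class c (c x)|.

Definition moves (u : G) : {set bell_k_graph G k} :=
  [set z | (z != P) && agree_off u P z].

(** If [u] stayed with one old class mate, it would stay with all of them and [z] would be [P]. *)
Lemma moved_apart u y z (d : G -> 'I_k) : z \in moves u ->
  represents (parts z) d -> y != u -> c y = c u -> d y != d u.
Proof.
rewrite inE => /andP[zP Pz] zd yu cyu; apply: contra_neq zP => dyu.
apply: (represents_inj zd Pc) => a b; have Pzd := agree_offP u Pc zd Pz.
have aux b' : b' != u -> (d u == d b') = (c u == c b').
  by move=> b'u; rewrite -dyu -cyu Pzd.
case: (eqVneq a u) => [->|au]; case: (eqVneq b u) => [->|bu].
- by rewrite !eqxx.
- exact: aux.
- by rewrite eq_sym aux // eq_sym.
by rewrite Pzd.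
Qed.

(** A class mate [y] of [u] other than [v] and [t] is apart from [u] in [z] but with [u] in [w];
    only moving [u] can explain this. *)
Lemma moves_sep u v z w t : z \in moves u -> w \in moves v ->
  agree_off t z w -> u != v -> t = u.
Proof.
move=> zu wv zw uv; apply/eqP/negPn/negP => tu.
have [dz zd _] := ex_label z; have [dw wd _] := ex_label w.
have [y [yc yu yv yt]] := ex_avoiding3 u v t (big u).
rewrite inE in yc; have := moved_apart zu zd yu (eqP yc).
rewrite (agree_offP t zd wd zw) 1?[u == t]eq_sym //.
rewrite inE in wv; case/andP: wv => _ Pw.
by rewrite -(agree_offP v Pc wd Pw) // yc.
Qed.

Lemma ex_move u l : (forall z, adj u z -> c z != l) -> c u != l ->
  exists2 z, z \in moves u & represents (parts z) (recolour c u l).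
Proof.
move=> ul cul; have [z zc] := ex_vertex (recolour_proper cP ul).
exists z => //; rewrite inE; apply/andP; split; last first.
  by apply/(agree_offP u Pc zc) => x y; rewrite /recolour => /negbTE-> /negbTE->.
have [y [yc yu _ _]] := ex_avoiding3 u u u (big u); rewrite inE in yc.
apply: contraNneq cul => zP; have := zc y u.
by rewrite zP Pc /recolour eqxx (negbTE yu) (eqP yc) eqxx => <-.
Qed.

(** A class mate of [u] is apart from [u] in [z] and with it in [w]. If neither step to [R] moved
    [u], then [R] would do both. *)
Lemma common_neighbour_moved u v l (z w R : bell_k_graph G k) s t : adj u v ->
  represents (parts z) (recolour c u l) -> represents (parts w) (recolour c v l) ->
  c u != l -> agree_off s R z -> agree_off t R w -> (u == s) || (u == t).
Proof.
move=> uv zc wc cul Rz Rw; apply: contraT; rewrite negb_or => /andP[us ut].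
have [r Rr _] := ex_label R.
have [y [yc yu ys yt]] := ex_avoiding3 u s t (big u); rewrite inE in yc.
have nuv : u != v by apply: contraTneq uv => ->; rewrite adj_irrefl.
have yv : y != v.
  by apply: contraTneq (cP uv) => <-; rewrite (eqP yc) eqxx.
have := agree_offP s Rr zc Rz u y us ys.
rewrite (agree_offP t Rr wc Rw u y ut yt) /recolour eqxx.
by rewrite (negbTE nuv) (negbTE yv) (negbTE yu) (eqP yc) eqxx eq_sym (negbTE cul).
Qed.

(* The cardinality alternative makes [l] the only unused colour. *)
Lemma common_neighbour_unique u v l (z w R : bell_k_graph G k) : adj u v ->
  (forall x, adj u x || adj v x -> c x != l) ->
  (exists y, c y = l) \/ k <= #|c @: [set: G]|.+1 ->
  represents (parts z) (recolour c u l) -> represents (parts w) (recolour c v l) ->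
  z \in moves u -> w \in moves v -> adj R z -> adj R w -> R = P.
Proof.
move=> uv lfree l_used zc wc zu wv.
rewrite !adjE => /andP[_ /existsP[s Rz]] /andP[_ /existsP[t Rw]].
have nuv : u != v by apply: contraTneq uv => ->; rewrite adj_irrefl.
have cul : c u != l by apply: lfree; rewrite [adj v u]adj_sym uv orbT.
have cvl : c v != l by apply: lfree; rewrite uv.
have [r Rr rP] := ex_label R.
have ust := common_neighbour_moved uv zc wc cul Rz Rw.
have vst : (v == t) || (v == s).
  have vu : adj v u by rewrite adj_sym.
  exact: common_neighbour_moved vu wc zc cvl Rw Rz.
have cuv := negbTE (cP uv); have ruv := negbTE (rP _ _ uv).
(* If [s = u] and [t = v], then [R] undoes both moves: it agrees with [P] off [u] and off [v], and
   the pair [u], [v] is apart in both. *)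
have [us|us] := eqVneq u s.
  have vt : v = t.
    by move: vst; rewrite -us eq_sym [v == u]eq_sym (negbTE nuv) orbF => /eqP.
  subst s t; have R1 x y : x != u -> y != u -> (r x == r y) = (c x == c y).
    move=> xu yu; rewrite (agree_offP u Rr zc Rz) //.
    by rewrite /recolour (negbTE xu) (negbTE yu).
  have R2 x y : x != v -> y != v -> (r x == r y) = (c x == c y).
    move=> xv yv; rewrite (agree_offP v Rr wc Rw) //.
    by rewrite /recolour (negbTE xv) (negbTE yv).
  apply: (represents_inj Rr Pc) => x y.
  have [->|xu] := eqVneq x u; have [->|yu] := eqVneq y u.
  - by rewrite !eqxx.
  - have [->|yv] := eqVneq y v; last by rewrite R2.
    by rewrite ruv cuv.
  - have [->|xv] := eqVneq x v; last by rewrite R2.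
    by rewrite eq_sym ruv eq_sym cuv.
  by rewrite R1.
(* Now [R] makes both moves. If [l] is a used colour, [u] and [v] fall into one part, which their
   edge forbids. *)
have ut : u = t by move: ust; rewrite (negbTE us) => /eqP.
have vs : v = s by move: vst; rewrite -ut [v == u]eq_sym (negbTE nuv) => /eqP.
subst s t; exfalso.
have Ru x : x != u -> x != v -> (r u == r x) = (l == c x).
  move=> xu xv; rewrite (agree_offP v Rr zc Rz) //.
  by rewrite /recolour eqxx (negbTE xu).
have Rv x : x != u -> x != v -> (r v == r x) = (l == c x).
  move=> xu xv; rewrite (agree_offP u Rr wc Rw) 1?[v == u]eq_sym //.
  by rewrite /recolour eqxx (negbTE xv).
have Rc x y : x != u -> x != v -> y != u -> y != v -> (r x == r y) = (c x == c y).
  move=> xu xv yu yv; rewrite (agree_offP v Rr zc Rz) //.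
  by rewrite /recolour (negbTE xu) (negbTE yu).
have [/existsP[y /eqP cy]|/existsPn nol] := boolP [exists y, c y == l].
  have yu : y != u by apply: contraNneq cul => <-; rewrite cy.
  have yv : y != v by apply: contraNneq cvl => <-; rewrite cy.
  have := Ru y yu yv; have := Rv y yu yv; rewrite cy eqxx => /eqP rvy /eqP ruy.
  by rewrite ruy rvy eqxx in ruv.
case: l_used => [[y /eqP]|]; first by rewrite (negbTE (nol y)).
pose S := ~: [set u; v].
have inS x : (x \in S) = (x != u) && (x != v) by rewrite !inE negb_or.
have le_c : #|c @: [set: G]| <= #|c @: S|.
  apply/subset_leq_card/subsetP => _ /imsetP[x _ ->].
  have [y [yc yu yv _]] := ex_avoiding3 u v v (big x); rewrite inE in yc.
  by apply/imsetP; exists y; rewrite ?inS ?yu // (eqP yc).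
have le_r : #|c @: S| <= #|r @: S|.
  apply: card_imset_coarser => x y; rewrite !inS => /andP[xu xv] /andP[yu yv].
  by move/eqP; rewrite Rc // => /eqP.
have uS : r u \notin r v |: r @: S.
  rewrite in_setU1 ruv /=; apply/imsetP => -[x].
  rewrite inS => /andP[xu xv] /eqP; rewrite Ru // eq_sym.
  by rewrite (negbTE (nol x)).
have vS : r v \notin r @: S.
  apply/imsetP => -[x]; rewrite inS => /andP[xu xv] /eqP; rewrite Rv // eq_sym.
  by rewrite (negbTE (nol x)).
have : #|r u |: (r v |: r @: S)| <= k.
  by rewrite -[leqRHS](card_ord k) max_card.
rewrite cardsU1 uS cardsU1 vS !add1n => rk /(leq_trans rk).
by rewrite ltnS ltnNge (leq_trans le_c le_r).
Qed.

Lemma bell_model : (exists l, forall x, c x != l) ->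
  (forall u v, adj u v -> exists2 l,
     forall x, adj u x || adj v x -> c x != l &
     (exists y, c y = l) \/ k <= #|c @: [set: G]|.+1) ->
  local_model P moves.
Proof.
move=> [l0 l0P] edge_label; split.
- move=> u; have [z zu _] := ex_move (fun z _ => l0P z) (l0P u).
  by exists z.
- move=> u z; rewrite inE => /andP[zP Pz].
  by case: (agree_adj Pz) => // PE; rewrite PE eqxx in zP.
- move=> u v z w zu wv zw; apply/eqP/negPn/negP => uv.
  have [t ztw] : exists t, agree_off t z w.
    case: zw => [->|]; first by exists u; apply: eqxx.
    by rewrite adjE => /andP[_ /existsP].
  have tu := moves_sep zu wv ztw uv; rewrite eq_sym in uv.
  have tv := moves_sep wv zu (agree_off_sym ztw) uv.
  by rewrite -tu -tv eqxx in uv.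
move=> u v uv; have [l lfree l_used] := edge_label u v uv.
have [|| z zu zc] := @ex_move u l.
- by move=> x ux; apply: lfree; rewrite ux.
- by apply: lfree; rewrite [adj v u]adj_sym uv orbT.
have [|| w wv wc] := @ex_move v l.
- by move=> x vx; apply: lfree; rewrite vx orbT.
- by apply: lfree; rewrite uv.
exists z, w; split=> // R; exact: common_neighbour_unique uv lfree l_used zc wc zu wv.
Qed.

End BellModel.

Lemma colour_class_inj (G : sgraph) m k (f : 'I_m -> 'I_k) (c : G -> 'I_m) x :
  injective f -> colour_class (f \o c) (f (c x)) = colour_class c (c x).
Proof. by move=> f_inj; apply/setP => y; rewrite !inE /= (inj_eq f_inj). Qed.

Lemma ex_bell_model (G : sgraph) k : 8 * max_degree G + 4 <= #|G| ->
  chromatic_number G < k -> exists P (X : G -> {set bell_k_graph G k}),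
    local_model P X.
Proof.
set D := max_degree G => nD chik; pose m := minn k.-1 (2 * D).+1.
have chim : chromatic_number G <= m.
  by have := chromatic_number_degree G; rewrite -/D; lia.
have mk : m < k by lia.
have /colourableP[c0 c0P] := chromatic_numberP G.
have wm_inj : injective (widen_ord chim) by move=> i j /(congr1 val)/= /val_inj.
have w_inj : injective (widen_ord (ltnW mk)).
  by move=> i j /(congr1 val)/= /val_inj.
have c0mP : proper_colouring (widen_ord chim \o c0).
  by move=> x y /c0P; rewrite /= (inj_eq wm_inj).
have [||c cP cbig] := ex_big_classes c0mP (@card_neighbours G); [lia | lia |].
have surj l : exists y, c y = l.
  have /set0Pn [y] : colour_class c l != set0.
    by rewrite -card_gt0; have := cbig l; lia.
  by rewrite inE => /eqP; exists y.
pose c' := widen_ord (ltnW mk) \o c.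
have c'P : proper_colouring c' by move=> x y /cP; rewrite /= (inj_eq w_inj).
have [P Pc] := ex_vertex c'P; exists P, (moves P).
have l_free x : c' x != Ordinal mk by rewrite -val_eqE /= neq_ltn ltn_ord.
apply: (bell_model c'P Pc).
- by move=> x; rewrite colour_class_inj.
- by exists (Ordinal mk).
move=> u v uv; have [mE|mE] := leqP k.-1 (2 * D).+1.
  exists (Ordinal mk) => //; right.
  have /subset_leq_card :
      [set widen_ord (ltnW mk) l | l : 'I_m] \subset c' @: [set: G].
    apply/subsetP => _ /imsetP[l _ ->]; have [y <-] := surj l.
    exact: (imset_f c').
  have : k <= m.+1 by rewrite /m; lia.
  by rewrite (card_imset _ w_inj) card_ord => km cm; apply: leq_trans km _.
(* Now [m = 2D + 1] exceeds the size of the two neighbourhoods together, so some used colour misses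
   both. *)
have [|l _ lP] := @free_label _ _ c (neighbours u :|: neighbours v) [set: 'I_m].
  rewrite cardsT card_ord; apply: leq_ltn_trans (leq_card_setU _ _) _.
  have := card_neighbours u; have := card_neighbours v; rewrite -/D; lia.
exists (widen_ord (ltnW mk) l) => [x uvx|].
  by rewrite /= (inj_eq w_inj) lP // !inE.
by left; have [y <-] := surj l; exists y.
Qed.

(** * From homomorphisms both ways to an isomorphism *)

(** Both maps are injective on ordered edges, so the edge counts agree and [f] maps onto the edges
    of [H]. *)
Lemma bijective_homs_iso (G H : sgraph) (f : G -> H) (g : H -> G) :
  bijective f -> (forall u v, adj u v -> adj (f u) (f v)) ->
  bijective g -> (forall u v, adj u v -> adj (g u) (g v)) -> isomorphic G H.
Proof.
move=> f_bij f_hom g_bij g_hom; exists f => // x y; apply/idP/idP; last exact: f_hom.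
pose E (K : sgraph) := [set e : K * K | adj e.1 e.2].
have hom_card (K L : sgraph) (h : K -> L) : injective h ->
    (forall u v, adj u v -> adj (h u) (h v)) ->
    (fun e => (h e.1, h e.2)) @: E K \subset E L /\
    #|(fun e => (h e.1, h e.2)) @: E K| = #|E K|.
  move=> h_inj h_hom; split; last first.
    by apply: card_imset => -[a b] [a' b'] [/h_inj-> /h_inj->].
  by apply/subsetP => _ /imsetP[e eE ->]; rewrite inE /= h_hom //; rewrite inE in eE.
have [fE cf] := hom_card _ _ f (bij_inj f_bij) f_hom.
have [gE cg] := hom_card _ _ g (bij_inj g_bij) g_hom.
move=> fxy; have : (f x, f y) \in (fun e => (f e.1, f e.2)) @: E G.
  suff -> : (fun e => (f e.1, f e.2)) @: E G = E H by rewrite inE.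
  by apply/eqP; rewrite eqEcard fE cf -cg subset_leq_card.
move=> /imsetP[[a b]]; rewrite inE /= => ab [xa yb].
by rewrite (bij_inj f_bij xa) (bij_inj f_bij yb).
Qed.

Lemma isomorphic_sym (G H : sgraph) : isomorphic G H -> isomorphic H G.
Proof.
move=> [f [g fK gK] f_mono]; exists g; first by exists f.
by move=> x y; rewrite -f_mono !gK.
Qed.

(** The premise [#|H| <= #|G|] will come from the same lemma with the graphs exchanged. *)
Lemma bell_transfer (G H : sgraph) k l : 8 * max_degree G + 4 <= #|G| ->
  chromatic_number G < k -> isomorphic (bell_k_graph G k) (bell_k_graph H l) ->
  #|G| <= #|H| /\ (#|H| <= #|G| ->
    exists2 f : G -> H, bijective f & forall u v, adj u v -> adj (f u) (f v)).
Proof.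
move=> nD chik [phi phi_bij phi_mono].
have [P [X /(local_model_iso phi_bij phi_mono) model]] := ex_bell_model nD chik.
by split; [apply: card_model model | apply: model_hom model].
Qed.

Lemma order_bound (G : sgraph) :
  ((max_degree G)%:R < 1 / 9 * #|G|%:R - 1 / 3 :> rat)%R ->
  8 * max_degree G + 4 <= #|G|.
Proof.
move=> hG; suff: 9 * max_degree G + 3 < #|G| by lia.
rewrite -(ltr_nat rat) natrD natrM; lra.
Qed.

Local Open Scope ring_scope.

Theorem theorem1p2 (G1 G2 : sgraph) (k1 k2 : nat)
  (hG1 : (max_degree G1)%:R < 1 / 9 * #|G1|%:R - 1 / 3 :> rat)
  (hG2 : (max_degree G2)%:R < 1 / 9 * #|G2|%:R - 1 / 3 :> rat)
  (hk1 : (chromatic_number G1 < k1)%N)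
  (hk2 : (chromatic_number G2 < k2)%N) :
  isomorphic (bell_k_graph G1 k1) (bell_k_graph G2 k2) -> isomorphic G1 G2.
Proof.
move=> /[dup] iso12 /isomorphic_sym iso21.
have [le12 hom12] := bell_transfer (order_bound hG1) hk1 iso12.
have [le21 hom21] := bell_transfer (order_bound hG2) hk2 iso21.
have [f f_bij f_hom] := hom12 le21; have [g g_bij g_hom] := hom21 le12.
exact: bijective_homs_iso f_bij f_hom g_bij g_hom.
Qed.
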